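(* Let $p,q,r,a,b,c$ be integers and let $w=p+q+r+a+b+c$. Then $$\left\langle K\left(\begin{smallmatrix} p & q & r\\ a & b & c\end{smallmatrix}\right)\right\rangle-\left\langle K\left(\begin{smallmatrix} p & q & r\\ b & a & c\end{smallmatrix}\right)\right\rangle=A^{-w}(S_pA^p-S_rA^r)(S_aA^a-S_bA^b)\,\bigl(1-(-A^2-A^{-2})^2\bigr),$$ $$\left\langle K\left(\begin{smallmatrix} p & q & r\\ a & b & c\end{smallmatrix}\right)\right\rangle-\left\langle K\left(\begin{smallmatrix} p & q & r\\ a & c & b\end{smallmatrix}\right)\right\rangle=A^{-w}(S_pA^p-S_qA^q)(S_cA^c-S_bA^b)\,\bigl(1-(-A^2-A^{-2})^2\bigr),$$ $$\left\langle K\left(\begin{smallmatrix} p & q & r\\ a & b & c\end{smallmatrix}\right)\right\rangle-\left\langle K\left(\begin{smallmatrix} p & q & r\\ c & b & a\end{smallmatrix}\right)\right\rangle=A^{-w}(S_qA^q-S_rA^r)(S_aA^a-S_cA^c)\,\bigl(1-(-A^2-A^{-2})^2\bigr),$$ $$\left\langle K\left(\begin{smallmatrix} p & q & r\\ a & b & c\end{smallmatrix}\right)\right\rangle-\left\langle K\left(\begin{smallmatrix} p & q & r\\ c & a & b\end{smallmatrix}\right)\right\rangle=A^{-w}\left|\begin{matrix} S_pA^p & S_qA^q & S_rA^r\\ S_cA^c & S_aA^a & S_bA^b\\ 1&1&1\end{matrix}\right|\,\bigl(1-(-A^2-A^{-2})^2\bigr),$$ $$\left\langle K\left(\begin{smallmatrix}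 p & q & r\\ a & b & c\end{smallmatrix}\right)\right\rangle-\left\langle K\left(\begin{smallmatrix} p & q & r\\ b & c & a\end{smallmatrix}\right)\right\rangle=-A^{-w}\left|\begin{matrix} S_pA^p & S_qA^q & S_rA^r\\ S_aA^a & S_bA^b & S_cA^c\\ 1&1&1\end{matrix}\right|\,\bigl(1-(-A^2-A^{-2})^2\bigr).$$
   Context: Twist regions. Let $e$ be an arc (an edge) in $S^2$ with two disjoint strands running parallel to $e$, one on each side. To put the integer label $n$ on $e$ means to twist these two strands about $e$ by $|n|$ half twists, producing a row of $|n|$ crossings along $e$ (none if $n=0$), all of sign $\operatorname{sign}(n)$ relative to $e$. A crossing is positive relative to $e$ if, when the picture (with $S^2$ viewed from a fixed side) is rotated locally so that $e$ is vertical, the overcrossing strand runs from upper left to lower right; it is negative if the overcrossing strand runs from lower left to upper right. The diagram $K\left(\begin{smallmatrix} p & q & r\\ a & b & c\end{smallmatrix}\right)$, for integers $p,q,r,a,b,c$. Divide a circle $C\subset S^2$ into six arcs $A_1,B_1,A_2,B_2,A_3,B_3$ in this cyclic order. In one complementary disk of $C$ (the inside) take a Y-shaped tree $T$ with one trivalent vertex and three legs ending at interior points of $A_1,A_2,A_3$, and three disjoint strands forming the boundary of a thin neighborhood of $T$, the $i$-th strand joining the two endpoints of $B_i$; two strands run along each leg. Put labels $p,q,r$ on the legs ending at $A_1,A_2,A_3$, respectively. In the other disk (the outside) take a Y-shaped tree $T'$ with legs ending at interior points of $B_1,B_2,B_3$ and three strands forming the boundary of a thin neighborhood of $T'$, the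 $i$-th strand joining the two endpoints of $A_i$; put labels $a,b,c$ on the legs ending at $B_1,B_2,B_3$, respectively. The union is the link diagram $K\left(\begin{smallmatrix} p & q & r\\ a & b & c\end{smallmatrix}\right)$. $\langle D\rangle\in\mathbb Z[A,A^{-1}]$ is the Kauffman bracket of an unoriented diagram $D$: it equals $1$ on a crossingless circle, $\langle D\sqcup\bigcirc\rangle=(-A^2-A^{-2})\langle D\rangle$, and at a crossing $\langle D\rangle=A\langle D_A\rangle+A^{-1}\langle D_B\rangle$, where $D_A$ is the smoothing joining the two regions swept out when the overcrossing strand is rotated counterclockwise towards the undercrossing strand. (Thus at a crossing positive relative to its edge, $D_A$ cuts across the edge and $D_B$ leaves two strands parallel to the edge.) For $n>0$, $S_n=S_n(A)=\sum_{i=1}^nA^{2-i}(-A^3)^{n-i}$; $S_{-n}(A)=S_n(A^{-1})$; and $S_0=0$ (the empty sum). *)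

(* Defs.v *)
From HB Require Import structures.
From mathcomp Require Import all_boot all_order all_algebra zify.

Set Implicit Arguments.
Unset Strict Implicit.
Unset Printing Implicit Defensive.

Import Order.TTheory GRing.Theory Num.Theory.

(** * Unoriented link diagrams

    A diagram is recorded by its crossings and its arcs, in the style of a
    planar diagram code.  Arcs may be subdivided by bivalent points, so that
    crossingless components are represented as well: [arcs] lists pairs of
    points joined by an arc away from the crossings, and a crossing lists the
    four points at its ends in counterclockwise order, the first and third
    being the ends of the undercrossing strand.  In a diagram each point is an
    end of exactly two of these pieces ([wf_diagram] below). *)

Record crossing (T : Type) := Crossing {
  under1 : T; over1 : T; under2 : T; over2 : T }.

Record diagram (T : Type) := Diagram {
  arcs : seq (T * T);
  crossings : seq (crossing T) }.

Section Diagrams.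
Variable T : choiceType.
Implicit Types (E : seq (T * T)) (X : seq (crossing T)) (c : crossing T).

Definition arc_points E : seq T := flatten [seq [:: e.1; e.2] | e <- E].

Definition crossing_points X : seq T :=
  flatten [seq [:: under1 c; over1 c; under2 c; over2 c] | c <- X].

Definition diagram_points (D : diagram T) : seq T :=
  arc_points (arcs D) ++ crossing_points (crossings D).

Definition wf_diagram (D : diagram T) : bool :=
  all (fun x => count_mem x (diagram_points D) == 2) (diagram_points D).

(** Turning the overcrossing strand counterclockwise, its half ending at
    [over1] sweeps the region between [over1] and [under2], and its other half
    the region between [over2] and [under1].  Smoothing A joins these two
    regions, smoothing B the other two. *)

Definition smoothA c := [:: (under1 c, over1 c); (under2 c, over2 c)].
Definition smoothB c := [:: (over1 c, under2 c); (over2 c, under1 c)].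

(** In a crossingless diagram every point has valency two, hence the circles
    are the connected components of the graph of arcs. *)

Definition arc_rel E : rel (seq_sub (arc_points E)) :=
  fun x y => ((val x, val y) \in E) || ((val y, val x) \in E).

Definition circles E : nat := n_comp (arc_rel (E := E)) predT.

End Diagrams.

(** * The Kauffman bracket

    The ring Z[A, A^-1] is viewed inside the fraction field of Z[A].  The
    crossings are resolved one after the other by the skein rule (their order
    is immaterial), and [n] disjoint circles have bracket [delta ^+ n.-1]. *)

Local Open Scope ring_scope.

Definition ratfun : Type := {fraction {poly int}}.
HB.instance Definition _ := GRing.Field.on ratfun.

Definition A : ratfun := tofrac 'X.

Definition delta : ratfun := - A ^+ 2 - A ^- 2.

Fixpoint bracket_of (T : choiceType) (E : seq (T * T)) (X : seq (crossing T)) :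
    ratfun :=
  if X is c :: X' then
    A * bracket_of (smoothA c ++ E) X' + A^-1 * bracket_of (smoothB c ++ E) X'
  else delta ^+ (circles E).-1.

Definition bracket (T : choiceType) (D : diagram T) : ratfun :=
  bracket_of (arcs D) (crossings D).

(** * The diagrams K

    [(true, i)] is the leg of T ending at the [i]-th arc A, in the inside disk,
    and [(false, i)] the leg of T' ending at the [i]-th arc B, in the outside
    disk; [i] is counted from 0.  The inside disk is drawn as a round disk in
    the plane, with the six arcs of C in counterclockwise order and all legs
    radial, directed away from the centre of the disk.  The point [(e, k, s)]
    lies beside the leg [e], at level [k] (levels increase away from the
    centre, and the [k]-th crossing along [e] lies between levels [k] and
    [k.+1]), to the left of [e] if [s] is [true] and to the right otherwise. *)

Definition leg : Type := (bool * 'I_3)%type.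
HB.instance Definition _ := Choice.on leg.

Definition point : Type := (leg * nat * bool)%type.
HB.instance Definition _ := Choice.on point.

Definition twist_crossing (positive : bool) (e : leg) (k : nat) :
    crossing point :=
  let bottom_left : point := (e, k, true) in
  let bottom_right : point := (e, k, false) in
  let top_left : point := (e, k.+1, true) in
  let top_right : point := (e, k.+1, false) in
  if positive then Crossing bottom_left bottom_right top_right top_left
  else Crossing bottom_right top_right top_left bottom_left.

Definition twist (e : leg) (n : int) : seq (crossing point) :=
  [seq twist_crossing (0 < n) e k | k <- iota 0 `|n|%N].

(** The strands, cut at the six division points of C and at the twist regions.
    Writing [B_i] for the arc of C between [A_i] and [A_(i+1)], the four arcs
    below are, in this order: the turn near the vertex of T of the strand
    joining the endpoints of [B_i]; the point of C common to [A_i] and [B_i];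
    the point of C common to [B_i] and [A_(i+1)]; the turn near the vertex of
    T' of the strand joining the endpoints of [A_(i+1)]. *)

Definition K_arcs (u v : 'I_3 -> int) : seq (point * point) :=
  flatten [seq
    [:: (((true, i), 0, true), ((true, ordS i), 0, false));
        (((true, i), `|u i|, true), ((false, i), 0, false));
        (((false, i), 0, true), ((true, ordS i), `|u (ordS i)|, false));
        (((false, i), `|v i|, true), ((false, ordS i), `|v (ordS i)|, false))]%N
    | i <- enum 'I_3].

Definition K_crossings (u v : 'I_3 -> int) : seq (crossing point) :=
  flatten [seq twist (true, i) (u i) ++ twist (false, i) (v i)
          | i <- enum 'I_3].

Definition K (p q r a b c : int) : diagram point :=
  let u := tnth [tuple p; q; r] in
  let v := tnth [tuple a; b; c] in
  Diagram (K_arcs u v) (K_crossings u v).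

Lemma enum3 :
  enum 'I_3 = [:: @Ordinal 3 0 isT; @Ordinal 3 1 isT; @Ordinal 3 2 isT].
Proof. by apply: (inj_map val_inj); rewrite val_enum_ord. Qed.

Lemma count_twist (e f : leg) (k : nat) (s : bool) (n : int) :
  count_mem ((e, k, s) : point) (crossing_points (twist f n)) =
  ((e == f) * ((k < `|n|) + (0 < k <= `|n|)))%N.
Proof.
rewrite /twist; set b := (0 < n)%R; set m := `|n|%N; clearbody b m.
elim: m => [|m IH]; first by case: k => [|k]; rewrite /= ?muln0.
rewrite -addn1 iotaD map_cat /crossing_points map_cat flatten_cat count_cat.
rewrite -!/(crossing_points _) IH {IH} /= add0n.
have E j t : ((f, j, t) == ((e, k, s) : point)) = [&& e == f, j == k & t == s].
  rewrite -pair_eqE /= -pair_eqE /=. by rewrite [f == e]eq_sym andbA.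
case: b => /=; rewrite !E {E}; case: (e == f) => //=; case: s => /=; lia.
Qed.

Lemma ordS0 : ordS (@Ordinal 3 0 isT) = @Ordinal 3 1 isT.
Proof. exact: val_inj. Qed.

Lemma ordS1 : ordS (@Ordinal 3 1 isT) = @Ordinal 3 2 isT.
Proof. exact: val_inj. Qed.

Lemma ordS2 : ordS (@Ordinal 3 2 isT) = @Ordinal 3 0 isT.
Proof. exact: val_inj. Qed.

Lemma level_count (n k : nat) :
  (0 < (0 == k) + ((n == k) + ((k < n) + (0 < k <= n))))%N ->
  ((0 == k) + ((n == k) + ((k < n) + (0 < k <= n))))%N = 2%N.
Proof. by lia. Qed.

Lemma K_wf p q r a b c : wf_diagram (K p q r a b c).
Proof.
apply/allP => -[[[d i] k] s] H; apply/eqP; move: H.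
rewrite -has_pred1 has_count.
rewrite /diagram_points /K /= /K_arcs /K_crossings enum3 /= /crossing_points.
rewrite !map_cat !flatten_cat -!/(crossing_points _) !count_cat !count_twist /=.
rewrite ordS0 ordS1 ordS2 !(tnth_nth 0) /=.
have PE (e f : leg) j t l u :
    ((e, j, t) == (f, l, u) :> point) = [&& e == f, j == l & t == u].
  by rewrite -pair_eqE /= -pair_eqE /= andbA.
rewrite !PE {PE}.
case: i => -[|[|[|//]]] hi; rewrite (bool_irrelevance hi isT) {hi};
  case: d; case: s => /=;
  rewrite ?eqxx ?andbT ?andbF ?mul1n ?mul0n ?addn0 ?add0n
    ?(addnCA (_ == _) (0 == _)); exact: level_count.
Qed.

(** * The Laurent polynomials S_n *)

Definition S_pos (n : nat) (x : ratfun) : ratfun :=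
  \sum_(1 <= i < n.+1) x ^ (2 - i%:Z) * (- x ^+ 3) ^+ (n - i).

Definition Spoly (n : int) (x : ratfun) : ratfun :=
  match n with
  | Posz m => S_pos m x
  | Negz m => S_pos m.+1 x^-1
  end.

Definition mx3 (R : nmodType) (rows : seq (seq R)) : 'M[R]_3 :=
  \matrix_(i, j) nth 0 (nth [::] rows i) j.

(* Main.v *)
Require Import Defs.
From HB Require Import structures.
From mathcomp Require Import all_boot all_order all_algebra.
From mathcomp Require Import zify ring.

Set Implicit Arguments.
Unset Strict Implicit.
Unset Printing Implicit Defensive.

Import Order.TTheory GRing.Theory Num.Theory.
Local Open Scope ring_scope.

(** Adding one crossing to a row of [n] crossings only uses that stacking two
    cut smoothings creates a circle, so a twist region labelled [n] resolves to
    [A^-n] times (two parallel strands plus [S_n A^n] times the cut across the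
    edge).  Thus the bracket of [K] is [A^-w] times a sum over 64 crossingless
    states, a polynomial in [delta] and the six weights [S_n A^n].

    The checkerboard graph of [K] is the complete graph on four vertices, with
    spokes [p], [q], [r] and rim [a], [b], [c].  Up to the term
    [(delta^2 - 1) (p b + q c + r a)], which pairs opposite edges, the state
    polynomial is symmetric in the spokes and in the rim separately, so this
    term alone contributes to the five differences. *)

(** * Counting circles *)

Section Components.
Variable T : choiceType.
Implicit Types (E : seq (T * T)) (x y z : T).

(* Union-find: [label E x] is a representative of the component of [x].  The
   local definitions let [vm_compute] evaluate it in polynomial time. *)
Fixpoint label E : T -> T :=
  if E is e :: E' then
    let h := label E' in let x := h e.1 in let y := h e.2 in
    fun z => let t := h z in if t == y then x else t
  else id.

Lemma label_arc E e : e \in E -> label E e.1 = label E e.2.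
Proof.
elim: E => //= e' E IH; rewrite inE => /predU1P[-> | /IH ->//].
by rewrite eqxx; case: eqP.
Qed.

Lemma label_arcs E x y : (x, y) \in E -> label E x = label E y.
Proof. exact: label_arc. Qed.

(** Each merge in [label] only identifies labels of points joined by an arc, so a function constant
    along arcs factors through [label E]. *)
Lemma label_univ (U : Type) (k : T -> U) E z :
  (forall e, e \in E -> k e.1 = k e.2) -> k (label E z) = k z.
Proof.
elim: E z => //= e E IH z kE.
have {}IH y : k (label E y) = k y.
  by apply: IH => e' e'E; apply: kE; rewrite inE e'E orbT.
case: eqP => [z2 | _]; last exact: IH.
by rewrite IH kE ?mem_head // -IH -z2 IH.
Qed.

Definition ncircles E := size (undup [seq label E x | x <- arc_points E]).

Lemma arc_pointsP E x :
  reflect (exists2 e, e \in E & (x == e.1) || (x == e.2)) (x \in arc_points E).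
Proof.
apply: (iffP flatten_mapP) => -[e eE xe]; exists e => //.
  by move: xe; rewrite !inE.
by rewrite !inE.
Qed.

Lemma arc_points1 E e : e \in E -> e.1 \in arc_points E.
Proof. by move=> eE; apply/arc_pointsP; exists e; rewrite ?eqxx. Qed.

Lemma arc_points2 E e : e \in E -> e.2 \in arc_points E.
Proof. by move=> eE; apply/arc_pointsP; exists e; rewrite ?eqxx ?orbT. Qed.

(** Labels are constant along paths; conversely the component root is constant along arcs, hence
    determined by the label. So the roots biject with the distinct labels. *)
Lemma circlesE E : circles E = ncircles E.
Proof.
pose S : finType := seq_sub (arc_points E).
pose phi (x : S) := label E (val x).
have conn (x y : S) : connect (arc_rel (E := E)) x y = (phi x == phi y).
  apply/idP/eqP => [/connectP[p] | xy].
    elim: p x => [|z p IH] x /=; first by move=> _ ->.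
    by case/andP=> /orP[] /label_arc /= xz /IH yz /yz; rewrite /phi xz.
  (* The root is extended by [None] off the arc points, as [label_univ] takes a function on all of
     [T]. *)
  pose k z := omap (fingraph.root (arc_rel (E := E))) (insub z : option S).
  have symE : connect_sym (arc_rel (E := E)).
    by apply: sym_connect_sym => u v; rewrite /arc_rel orbC.
  have kE e : e \in E -> k e.1 = k e.2.
    move=> eE; rewrite /k (insubT (mem (arc_points E)) (arc_points1 eE)).
    rewrite (insubT (mem (arc_points E)) (arc_points2 eE)) /=; congr Some.
    by apply/eqP; rewrite root_connect // connect1 // /arc_rel /= -surjective_pairing eE.
  have := congr1 k xy; rewrite /phi !(label_univ _ kE) /k !valK /= => -[].
  by move/eqP; rewrite root_connect.
have symE : connect_sym (arc_rel (E := E)).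
  by apply: sym_connect_sym => u v; rewrite /arc_rel orbC.
rewrite /circles /n_comp_mem cardE -(size_map phi).
apply/perm_size/uniq_perm; rewrite ?undup_uniq //.
  rewrite map_inj_in_uniq ?enum_uniq // => x y.
  rewrite !mem_enum !inE !andbT => /eqP rx /eqP ry /eqP.
  by rewrite -conn -root_connect // rx ry => /eqP.
move=> z; rewrite mem_undup; apply/mapP/mapP => -[x].
  by move=> _ ->; exists (val x) => //; apply: valP.
move=> xE ->; exists (fingraph.root (arc_rel (E := E)) (Sub x xE)).
  by rewrite mem_enum inE /= roots_root.
by apply/eqP; rewrite -/(phi (Sub x xE)) -conn connect_root.
Qed.

End Components.

(** The hypotheses make [f] induce a surjection from the components of [E] onto those of [F]. *)
Lemma leq_circles (T U : choiceType) (f : T -> U)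
    (E : seq (T * T)) (F : seq (U * U)) :
    (forall e, e \in E -> label F (f e.1) = label F (f e.2)) ->
    (forall y, y \in arc_points F ->
       exists2 x, x \in arc_points E & label F (f x) = label F y) ->
  (circles F <= circles E)%N.
Proof.
move=> fE sE; rewrite !circlesE /ncircles.
pose h x := label F (f x).
have hE x : h (label E x) = h x by apply: label_univ.
rewrite -(size_map h (undup _)); apply: uniq_leq_size (undup_uniq _) _ => z.
rewrite mem_undup => /mapP[y /sE[x xE fx] ->]; apply/mapP.
exists (label E x); last by rewrite hE /h fx.
by rewrite mem_undup map_f.
Qed.

(** * Local moves on arcs and their effect on circles and brackets *)

Section Moves.
Variable T : choiceType.
Implicit Types (E F : seq (T * T)) (x y z : T).

Lemma circles_loop x E :
  circles ((x, x) :: E) = ((x \notin arc_points E) + circles E)%N.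
Proof.
rewrite !circlesE /ncircles /=.
have lE z : (if label E z == label E x then label E x else label E z)
            = label E z by case: eqP.
rewrite eqxx (eq_map lE) inE eqxx /=.
have -> : (label E x \in [seq label E i | i <- arc_points E])
          = (x \in arc_points E).
  apply/mapP/idP => [[y yE xy] | xE]; last by exists x.
  (* Lying on an arc of [E] is itself constant along arcs, so a point off [E] shares its label with
     no point of [E]. *)
  pose k t := t \in arc_points E.
  have kE e : e \in E -> k e.1 = k e.2.
    by move=> eE; rewrite /k arc_points1 ?arc_points2.
  by rewrite -/(k x) -(label_univ x kE) xy (label_univ y kE).
by case: (x \in _).
Qed.

Local Arguments label : simpl never.

Lemma eq_mem_circles E E' : E =i E' -> circles E = circles E'.
Proof.
suff leq F F' : F =i F' -> (circles F' <= circles F)%N.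
  by move=> eqE; apply/eqP; rewrite eqn_leq !leq // => e; rewrite eqE.
move=> eqF; apply: (@leq_circles _ _ id) => [e | y].
  by rewrite eqF; apply: label_arc.
case/arc_pointsP=> e eF ye; exists y => //.
by apply/arc_pointsP; exists e; rewrite ?eqF.
Qed.

(** Both [f] and the inclusion of the points of [E'] are surjective on components; this gives the
    two inequalities. *)
Lemma circles_retract (f : T -> T) E E' :
    (forall e, e \in E -> label E' (f e.1) = label E' (f e.2)) ->
    (forall e, e \in E' -> label E e.1 = label E e.2) ->
    (forall x, x \in arc_points E ->
       f x \in arc_points E' /\ label E (f x) = label E x) ->
    (forall x, x \in arc_points E' -> x \in arc_points E /\ f x = x) ->
  circles E = circles E'.
Proof.
move=> fE iE' fK iK; apply/eqP; rewrite eqn_leq; apply/andP; split.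
  by apply: (leq_circles (f := id)) => // x /fK[]; exists (f x).
by apply: (leq_circles fE) => x /iK[xE fx]; exists x; rewrite ?fx.
Qed.

Lemma circles_swap x y E : circles ((x, y) :: E) = circles ((y, x) :: E).
Proof.
suff leq u v : (circles ((v, u) :: E) <= circles ((u, v) :: E))%N.
  by apply/eqP; rewrite eqn_leq !leq.
apply: (@leq_circles _ _ id) => [e | z].
  rewrite inE => /predU1P[-> | eE]; last by apply: label_arc; rewrite inE eE orbT.
  by apply/esym/label_arcs; rewrite mem_head.
by rewrite /= !inE orbCA; exists z; rewrite ?inE.
Qed.

Lemma circles_path x y z E : y \notin x :: z :: arc_points E ->
  circles ((x, y) :: (y, z) :: E) = circles ((x, z) :: E).
Proof.
rewrite !inE !negb_or => /and3P[yx yz yE].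
pose f t := if t == y then z else t.
have fid t : t != y -> f t = t by rewrite /f => /negPf->.
have nEy t : t \in arc_points E -> t != y by apply: contraTneq => ->.
have xzx : label ((x, y) :: (y, z) :: E) x = label ((x, y) :: (y, z) :: E) z.
  by rewrite (@label_arcs _ _ x y) ?(@label_arcs _ _ y z) ?inE ?eqxx ?orbT.
have fy : f y = z by rewrite /f eqxx.
have [fx fz] : f x = x /\ f z = z by rewrite !fid // eq_sym.
apply: (@circles_retract f) => [e | e | t | t].
- rewrite !inE => /or3P[/eqP-> | /eqP-> | eE] /=; rewrite ?fx ?fy ?fz //.
    by apply: label_arcs; rewrite mem_head.
  rewrite !fid ?nEy ?arc_points1 ?arc_points2 //.
  by apply: label_arc; rewrite inE eE orbT.
- rewrite inE => /predU1P[-> // | eE].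
  by apply: label_arc; rewrite !inE eE !orbT.
- have [-> _ | ty] := eqVneq t y.
    rewrite fy; split; first by rewrite !inE eqxx orbT.
    by rewrite (@label_arcs _ _ y z) ?inE ?eqxx ?orbT.
  by rewrite fid //= !inE (negPf ty) /=; split.
- rewrite !inE => tE; split; first by case/or3P: tE => ->; rewrite ?orbT.
  by case/or3P: tE => [/eqP-> | /eqP-> | /nEy /fid].
Qed.

Lemma circles_path3 x y y' z E :
    y != y' -> y \notin x :: z :: arc_points E ->
    y' \notin x :: z :: arc_points E ->
  circles ((x, y) :: (y, y') :: (y', z) :: E) = circles ((x, z) :: E).
Proof.
move=> yy' yE y'E; rewrite circles_path ?circles_path //.
by move: yE; rewrite /= !inE (negPf yy') !negb_or => /and3P[-> -> ->].
Qed.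

Lemma circles_gt0 e E : (0 < circles (e :: E))%N.
Proof.
rewrite circlesE /ncircles -has_predT; apply/hasP; exists (label (e :: E) e.1) => //.
by rewrite mem_undup map_f // arc_points1 ?mem_head.
Qed.

(** Smoothing [X] only adds arcs [F] between ends of its crossings, all in [P]; as the skein rule is
    linear, a factor common to all such completions passes to the bracket. *)
Lemma bracket_of_scale (s : ratfun) (P : pred T) E E' X :
    (forall F, {subset arc_points F <= P} ->
       delta ^+ (circles (F ++ E)).-1 = s * delta ^+ (circles (F ++ E')).-1) ->
    {subset crossing_points X <= P} ->
  bracket_of E X = s * bracket_of E' X.
Proof.
move=> sE; suff main F : {subset arc_points F <= P} ->
    {subset crossing_points X <= P} ->
    bracket_of (F ++ E) X = s * bracket_of (F ++ E') X by apply: (main [::]).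
elim: X F => [|c X IH] F FP XP /=; first exact: sE.
have [u1P o1P u2P o2P] : [/\ P (under1 c), P (over1 c), P (under2 c) & P (over2 c)].
  by split; apply: XP; rewrite !inE eqxx ?orbT.
have XP' : {subset crossing_points X <= P} by move=> x xX; apply: XP; rewrite !inE xX !orbT.
rewrite -!cat_cons !IH //; last 2 first.
- by move=> x; rewrite !inE => /or4P[/eqP-> | /eqP-> | /eqP-> | /predU1P[-> | /FP]].
- by move=> x; rewrite !inE => /or4P[/eqP-> | /eqP-> | /eqP-> | /predU1P[-> | /FP]].
by ring.
Qed.

Lemma eq_bracket_of (P : pred T) E E' X :
    (forall F, {subset arc_points F <= P} -> circles (F ++ E) = circles (F ++ E')) ->
    {subset crossing_points X <= P} ->
  bracket_of E X = bracket_of E' X.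
Proof.
move=> eqE XP; rewrite -[RHS]mul1r; apply: bracket_of_scale XP => F FP.
by rewrite mul1r eqE.
Qed.

End Moves.

(** * Resolving a twist region *)

Section Ladder.
Variable T : choiceType.
Implicit Types (E F : seq (T * T)) (x y : T).

Lemma arc_points_cat E F : arc_points (E ++ F) = arc_points E ++ arc_points F.
Proof. by rewrite /arc_points map_cat flatten_cat. Qed.

Lemma eq_mem_bracket_of E E' X : E =i E' -> bracket_of E X = bracket_of E' X.
Proof.
move=> eqE; apply: (@eq_bracket_of _ predT) => // F _.
by apply: eq_mem_circles => e; rewrite !mem_cat eqE.
Qed.

Lemma bracket_of_swap x y E X :
  bracket_of ((x, y) :: E) X = bracket_of ((y, x) :: E) X.
Proof.
apply: (@eq_bracket_of _ predT) => // F _.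
have front e : circles (F ++ e :: E) = circles (e :: F ++ E).
  by apply: eq_mem_circles => z; rewrite !(mem_cat, inE) orbCA.
by rewrite !front circles_swap.
Qed.

Ltac eq_mem_tac :=
  let e := fresh in move=> e; rewrite !(mem_cat, inE);
  do ![case: (e == _) => //= | case: (e \in _) => //=].

Variables (bl br ml mr tl tr : T) (G : seq (T * T)).
Let outside := bl :: br :: tl :: tr :: arc_points G.
Hypotheses (mlr : ml != mr) (mlP : ml \notin outside) (mrP : mr \notin outside).


(** This lemma and the next three stack two smoothings at the middle points, the upper one listed
    first: rails run along the edge, rungs cut it. Rails are neutral, and two cuts give one cut plus
    a circle. *)
Lemma circles_rails_rails :
  circles [:: (ml, tl), (mr, tr), (bl, ml), (br, mr) & G]
  = circles [:: (bl, tl), (br, tr) & G].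
Proof.
rewrite (@eq_mem_circles _ _ [:: (bl, ml), (ml, tl), (br, mr), (mr, tr) & G]);
  last by eq_mem_tac.
rewrite circles_path; last first.
  move: mlP; rewrite /outside /= !inE !negb_or mlr.
  by case/and5P=> -> -> -> -> ->.
rewrite (@eq_mem_circles _ _ [:: (br, mr), (mr, tr), (bl, tl) & G]);
  last by eq_mem_tac.
rewrite circles_path; last first.
  move: mrP; rewrite /outside /= !inE !negb_or.
  by case/and5P=> -> -> -> -> ->.
by apply: eq_mem_circles; eq_mem_tac.
Qed.

Lemma circles_rails_rungs :
  circles [:: (ml, tl), (mr, tr), (bl, br), (ml, mr) & G]
  = circles [:: (bl, br), (tl, tr) & G].
Proof.
rewrite circles_swap.
rewrite (@eq_mem_circles _ _ [:: (tl, ml), (ml, mr), (mr, tr), (bl, br) & G]);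
  last by eq_mem_tac.
move: mlP mrP; rewrite /outside !inE !negb_or.
move=> /and5P[a1 a2 a3 a4 a5] /and5P[b1 b2 b3 b4 b5].
rewrite circles_path3 //= ?inE ?negb_or ?a1 ?a2 ?a3 ?a4 ?a5 ?b1 ?b2 ?b3 ?b4 ?b5 //.
by apply: eq_mem_circles; eq_mem_tac.
Qed.

Lemma circles_rungs_rails :
  circles [:: (ml, mr), (tl, tr), (bl, ml), (br, mr) & G]
  = circles [:: (bl, br), (tl, tr) & G].
Proof.
rewrite (@eq_mem_circles _ _ [:: (br, mr), (bl, ml), (ml, mr), (tl, tr) & G]);
  last by eq_mem_tac.
rewrite circles_swap.
rewrite (@eq_mem_circles _ _ [:: (bl, ml), (ml, mr), (mr, br), (tl, tr) & G]);
  last by eq_mem_tac.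
move: mlP mrP; rewrite /outside !inE !negb_or.
move=> /and5P[a1 a2 a3 a4 a5] /and5P[b1 b2 b3 b4 b5].
by rewrite circles_path3 //= ?inE ?negb_or ?a1 ?a2 ?a3 ?a4 ?a5 ?b1 ?b2 ?b3 ?b4 ?b5.
Qed.

Lemma circles_rungs_rungs :
  circles [:: (ml, mr), (tl, tr), (bl, br), (ml, mr) & G]
  = (circles [:: (bl, br), (tl, tr) & G]).+1.
Proof.
rewrite (@eq_mem_circles _ _ [:: (ml, mr), (ml, mr), (bl, br), (tl, tr) & G]);
  last by eq_mem_tac.
move: mlP mrP; rewrite /outside !inE !negb_or.
move=> /and5P[a1 a2 a3 a4 a5] /and5P[b1 b2 b3 b4 b5].
(* The doubled middle rung contracts to a loop at [mr], the additional circle. *)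
rewrite circles_swap circles_path; last first.
  by rewrite /= !inE !negb_or mlr a1 a2 a3 a4 a5.
by rewrite circles_loop /= !inE !negb_or b1 b2 b3 b4 b5.
Qed.

End Ladder.

Lemma A_neq0 : A != 0.
Proof. by rewrite /A tofrac_eq0 polyX_eq0. Qed.

Lemma S_posS (m : nat) (x : ratfun) :
  S_pos m.+1 x = x ^ (1 - m%:Z) - x ^+ 3 * S_pos m x.
Proof.
rewrite /S_pos big_nat_recr //= subnn expr0 mulr1 addrC; congr (x ^ _ + _).
  by lia.
have gen (u y z : ratfun) : - (u * (- y * z)) = y * (u * z).
  by rewrite mulrCA mulNr opprK.
apply: oppr_inj; rewrite opprK -sumrN mulr_sumr.
apply: eq_big_nat => i /andP[_ im].
by rewrite -gen -exprS subSn.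
Qed.

Definition rung (e : leg) (k : nat) : point * point := ((e, k, true), (e, k, false)).

Definition rail (e : leg) (s : bool) (j k : nat) : point * point :=
  ((e, j, s), (e, k, s)).

(* Mirroring exchanges [A] and its inverse, so that both signs are treated at
   once. *)
Definition sgA (positive : bool) : ratfun := if positive then A else A^-1.

Lemma sgA_neq0 b : sgA b != 0.
Proof. by case: b; rewrite /sgA ?invr_eq0 A_neq0. Qed.

Lemma delta_sgA b : delta = - sgA b ^+ 2 - sgA b ^- 2.
Proof.
have gen (F : fieldType) (x : F) : - x ^+ 2 - x ^- 2 = - x^-1 ^+ 2 - x^-1 ^- 2.
  by rewrite exprVn invrK addrC.
by case: b; [reflexivity | exact: (gen _ A)].
Qed.

(** At a negative crossing smoothing A runs parallel to the edge and smoothing B cuts it; [sgA]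
    absorbs this exchange. *)
Lemma bracket_of_twist_crossing b e k E X :
  bracket_of E (twist_crossing b e k :: X)
  = sgA b * bracket_of [:: rung e k, rung e k.+1 & E] X
    + (sgA b)^-1
      * bracket_of [:: rail e true k k.+1, rail e false k k.+1 & E] X.
Proof.
have swap2 (u v : point * point) :
    bracket_of [:: u, v & E] X = bracket_of [:: v, u & E] X.
  by apply: eq_mem_bracket_of => t; rewrite !inE orbCA.
have railsE : bracket_of [:: rail e false k k.+1, rail e true k.+1 k & E] X
    = bracket_of [:: rail e true k k.+1, rail e false k k.+1 & E] X.
  by rewrite swap2 bracket_of_swap.
have rungsE : bracket_of (((e, k.+1, false), (e, k.+1, true)) :: rung e k :: E) X
    = bracket_of [:: rung e k, rung e k.+1 & E] X.
  by rewrite bracket_of_swap swap2.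
case: b; rewrite [LHS]/=.
  rewrite -rungsE -railsE; congr (_ + _); congr (_ * _); exact: swap2.
rewrite -rungsE -railsE addrC /sgA invrK; congr (_ + _).
Qed.

(** Here [x * d + x^-1 = - x ^+ 3], which is the factor in the recursion [S_posS]. *)
Lemma twist_algebra (F : fieldType) (x y d s R C : F) :
    x != 0 -> d = - x ^+ 2 - x ^- 2 ->
  x * (y * C + s * (d * C)) + x^-1 * (y * R + s * C)
  = x^-1 * y * R + (x * y - x ^+ 3 * s) * C.
Proof. by move=> x0 ->; field. Qed.

(** Induction from the bottom: the lowest crossing is smoothed and stacked under the resolved rest.
    Nothing else meets the intermediate levels, so the ladder lemmas apply there. *)
Lemma bracket_of_twist (b : bool) (e : leg) (j m : nat)
    (E : seq (point * point)) (X : seq (crossing point)) :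
    (forall k s, (j < k < j + m)%N ->
       (e, k, s) \notin arc_points E ++ crossing_points X) ->
    (forall s, (e, j, s) \in arc_points E) ->
  bracket_of E ([seq twist_crossing b e k | k <- iota j m] ++ X)
  = sgA b ^- m
      * bracket_of [:: rail e true j (j + m), rail e false j (j + m) & E] X
    + S_pos m (sgA b) * bracket_of [:: rung e j, rung e (j + m) & E] X.
Proof.
have S0 : S_pos 0 (sgA b) = 0 by rewrite /S_pos big_geq.
elim: m j E => [|m IH] j E avoid jE.
  (* With no crossings the rails are loops at points already on arcs, hence add no circle. *)
  rewrite S0 mul0r addr0 expr0 invr1 mul1r addn0.
  apply: (@eq_bracket_of _ predT) => // F _.
  have jFE s : (e, j, s) \in arc_points (F ++ E).
    by rewrite arc_points_cat mem_cat jE orbT.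
  rewrite (@eq_mem_circles _ (F ++ [:: _, _ & E])
             [:: rail e true j j, rail e false j j & F ++ E]); last first.
    by move=> z; rewrite !(mem_cat, inE); case: (z \in F); rewrite ?orbT ?orbF.
  by rewrite /rail !circles_loop /= !inE !jFE !orbT.
rewrite [iota _ _]/= map_cons cat_cons bracket_of_twist_crossing.
(* A single crossing is treated apart: its upper level ends the row, where other arcs may attach, so
   the ladder lemmas do not apply. *)
case: m => [|m] in IH avoid *.
  rewrite addn1 S_posS S0 mulr0 subr0 [1 - _]/= addrC.
  by congr (_ + _).
have mid s : (e, j.+1, s) \notin arc_points E ++ crossing_points X.
  by apply: avoid; lia.
have below k s l s' : (j.+1 < k)%N -> (l <= j.+1)%N ->
    ((e, k, s) : point) != (e, l, s').
  by move=> jk lj; apply: contraTneq jk => -[-> _]; rewrite -leqNgt.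
have kE k s : (j.+1 < k < j.+1 + m.+1)%N ->
    (e, k, s) \notin arc_points E ++ crossing_points X.
  by move=> kj; apply: avoid; lia.
rewrite !IH; first last.
- by move=> s; rewrite !inE; case: s; rewrite eqxx ?orbT.
- move=> k s kj; have n l s' := below k s l s' (proj1 (andP kj)).
  by rewrite /= !inE !negb_or !n ?leqnn ?leqnSn //; exact: kE.
- by move=> s; rewrite !inE; case: s; rewrite eqxx ?orbT.
- move=> k s kj; have n l s' := below k s l s' (proj1 (andP kj)).
  by rewrite /= !inE !negb_or !n ?leqnn ?leqnSn //; exact: kE.
rewrite addSnnS; set t := (j + m.+2)%N.
pose P : pred point := [pred z | (z != (e, j.+1, true)) && (z != (e, j.+1, false))].
have XP : {subset crossing_points X <= P}.
  move=> z zX; have nX s : z != (e, j.+1, s).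
    by apply: contraNneq (mid s) => <-; rewrite mem_cat zX orbT.
  by rewrite inE /= !nX.
have PE F s : {subset arc_points F <= P} ->
    (e, j.+1, s) \notin [:: (e, j, true) : point, (e, j, false), (e, t, true),
                            (e, t, false) & arc_points (F ++ E)].
  move=> FP; rewrite !inE arc_points_cat mem_cat.
  have /negPf-> : (e, j.+1, s) \notin arc_points E.
    by move: (mid s); rewrite mem_cat negb_or => /andP[].
  have /negPf-> : (e, j.+1, s) \notin arc_points F.
    by apply/negP => /FP; rewrite inE /=; case: s; rewrite eqxx ?andbF.
  by rewrite -!pair_eqE /= -!pair_eqE /= eqxx /t; case: s; lia.
have LR : (e, j.+1, true) != (e, j.+1, false) :> point by rewrite -pair_eqE /= andbF.
have front F (u v w z : point * point) :
  circles (F ++ [:: u, v, w, z & E]) = circles [:: u, v, w, z & F ++ E].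
  apply: eq_mem_circles => y; rewrite !(mem_cat, inE).
  by case: (y \in F); rewrite ?orbT.
have front2 F (u v : point * point) :
  circles (F ++ [:: u, v & E]) = circles [:: u, v & F ++ E].
  apply: eq_mem_circles => y; rewrite !(mem_cat, inE).
  by case: (y \in F); rewrite ?orbT.
(* In [cc], [cr], [rc], [rr] the first letter stands for the upper part, the second for the lowest
   crossing; [c] is a cut, [r] a pair of rails. *)
have cc : bracket_of [:: rung e j.+1, rung e t, rung e j, rung e j.+1 & E] X
    = delta * bracket_of [:: rung e j, rung e t & E] X.
  apply: bracket_of_scale XP => F FP.
  rewrite front front2 circles_rungs_rungs ?PE // -exprS prednK //.
  exact: circles_gt0.
have cr : bracket_of [:: rung e j.+1, rung e t, rail e true j j.+1,
                         rail e false j j.+1 & E] X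
    = bracket_of [:: rung e j, rung e t & E] X.
  apply: eq_bracket_of XP => F FP.
  by rewrite front front2 circles_rungs_rails ?PE.
have rc : bracket_of [:: rail e true j.+1 t, rail e false j.+1 t,
                         rung e j, rung e j.+1 & E] X
    = bracket_of [:: rung e j, rung e t & E] X.
  apply: eq_bracket_of XP => F FP.
  by rewrite front front2 circles_rails_rungs ?PE.
have rr : bracket_of [:: rail e true j.+1 t, rail e false j.+1 t,
                         rail e true j j.+1, rail e false j j.+1 & E] X
    = bracket_of [:: rail e true j t, rail e false j t & E] X.
  apply: eq_bracket_of XP => F FP.
  by rewrite front front2 circles_rails_rails ?PE.
rewrite cc cr rc rr.
rewrite (twist_algebra _ _ _ _ (sgA_neq0 b) (delta_sgA b)).
rewrite [in RHS]S_posS; congr (_ * _ + (_ - _) * _).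
  by rewrite [in RHS]exprS invfM.
by rewrite expfzDr ?sgA_neq0 // expr1z exprnN.
Qed.

(** * The state sum *)

(* The ends of a twist region: [(e, t, s)] is the outer end of [e] if [t] is
   [true], its inner end otherwise, on the left if [s] is [true]. *)
Definition twist_end : Type := (leg * bool * bool)%type.
HB.instance Definition _ := Choice.on twist_end.

Implicit Types (e : leg) (E : seq (twist_end * twist_end)) (L : seq leg).

Definition parallel e : seq (twist_end * twist_end) :=
  [:: ((e, false, true), (e, true, true)); ((e, false, false), (e, true, false))].

Definition across e : seq (twist_end * twist_end) :=
  [:: ((e, false, true), (e, false, false)); ((e, true, true), (e, true, false))].

(** Parallel strands weigh 1, the powers [A^-n] being taken out in front. Over an abstract ring the
    sum expands to a polynomial. *)
Fixpoint state_sum (R : nzRingType) (d : R) (y : leg -> R) L E : R :=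
  if L is e :: L' then
    state_sum d y L' (parallel e ++ E) + y e * state_sum d y L' (across e ++ E)
  else d ^+ (ncircles E).-1.

(** Twist ends do not involve the labels, so one evaluation on them covers all integers; [place]
    recovers the points of the diagram. *)
Definition place (N : leg -> nat) (x : twist_end) : point :=
  (x.1.1, if x.1.2 then N x.1.1 else 0%N, x.2).

Definition place_arcs N E := [seq (place N a.1, place N a.2) | a <- E].

Lemma arc_points_place N E : arc_points (place_arcs N E) = map (place N) (arc_points E).
Proof. by elim: E => //= a E IH; congr [:: _, _ & _]. Qed.

(* A label 0 identifies the inner and outer ends, which is harmless when they
   are joined by parallel strands. *)
Lemma circles_place N E :
  (forall e, N e = 0%N -> {subset parallel e <= E}) ->
  circles (place_arcs N E) = circles E.
Proof.
move=> parE; apply/eqP; rewrite eqn_leq; apply/andP; split.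
  apply: (@leq_circles _ _ (place N)) => [a aE | y].
    by apply: label_arcs; apply: map_f aE.
  by rewrite arc_points_place => /mapP[x xE ->]; exists x.
pose top (z : point) : twist_end := (z.1.1, z.1.2 != 0%N, z.2).
have topK x : label E (top (place N x)) = label E x.
  case: x => [[e [] s]] //; rewrite /top /place /=.
  have [/parE eE | //] := eqVneq (N e) 0%N.
  by apply: label_arcs; apply: eE; case: s; rewrite !inE eqxx ?orbT.
apply: (@leq_circles _ _ top) => [a' /mapP[a aE ->] /= | x xE].
  by rewrite !topK; apply: label_arc.
by exists (place N x); rewrite ?topK // arc_points_place map_f.
Qed.

Lemma crossing_points_cat (T : choiceType) (X Y : seq (crossing T)) :
  crossing_points (X ++ Y) = crossing_points X ++ crossing_points Y.
Proof. by rewrite /crossing_points map_cat flatten_cat. Qed.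

Lemma crossing_points_twists (n : leg -> int) L e k s :
  e \notin L ->
  (e, k, s) \notin crossing_points (flatten [seq twist f (n f) | f <- L]).
Proof.
elim: L => //= f L IH; rewrite inE negb_or => /andP[/negPf ef eL].
rewrite crossing_points_cat mem_cat negb_or IH // andbT.
by rewrite -has_pred1 has_count count_twist ef.
Qed.

(** Since [S_{-n}(A) = S_n(A^{-1})], both signs read alike in terms of [n]. *)
Lemma twist_weights (n : int) :
  (sgA (0 < n) ^- `|n| = A ^ (- n)) *
  (S_pos `|n| (sgA (0 < n)) = A ^ (- n) * (Spoly n A * A ^ n)).
Proof.
have ->: A ^ (- n) * (Spoly n A * A ^ n) = Spoly n A.
  by rewrite mulrCA -expfzDr ?A_neq0 // addNr expr0z mulr1.
case: n => [[|m]|m]; split=> //.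
- by rewrite oppr0 expr0z expr0 invr1.
- by rewrite /Spoly /S_pos !big_geq.
- by rewrite NegzE opprK /sgA /= exprVn invrK.
Qed.

(** Induction on the legs still to be resolved. The second hypothesis says that resolved legs of
    label 0 are parallel, as [circles_place] requires. *)
Lemma bracket_of_twists (n : leg -> int) L E :
    uniq L ->
    (forall e, e \notin L -> n e = 0 -> {subset parallel e <= E}) ->
    (forall e s, (e, false, s) \in arc_points E) ->
  bracket_of (place_arcs (fun e => `|n e|%N) E)
             (flatten [seq twist e (n e) | e <- L])
  = (\prod_(e <- L) A ^ (- n e))
    * state_sum delta (fun e => Spoly (n e) A * A ^ n e) L E.
Proof.
set N := fun e => `|n e|%N.
elim: L E => [|e L IH] E; cbn [uniq].
  move=> _ parE _; rewrite big_nil mul1r /= -circlesE circles_place // => e.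
  by rewrite /N => /eqP; rewrite absz_eq0 => /eqP; apply: parE.
case/andP=> eL uL parE botE.
rewrite map_cons big_cons.
rewrite [flatten _]/(twist e (n e) ++ flatten [seq twist e (n e) | e <- L]).
rewrite [twist e (n e)]/twist bracket_of_twist; last 2 first.
- move=> k s kn; rewrite mem_cat negb_or crossing_points_twists // andbT.
  rewrite arc_points_place; apply/mapP => -[[[f t] u] _ [ef kE _]].
  by move: kn; rewrite kE -ef; case: t {kE} => //; rewrite /N ltnn andbF.
- by move=> s; rewrite arc_points_place; apply/mapP; exists (e, false, s).
rewrite !twist_weights add0n.
rewrite -[X in _ * bracket_of X _ + _]/(place_arcs N (parallel e ++ E)).
rewrite -[X in _ + _ * bracket_of X _]/(place_arcs N (across e ++ E)).
have bot F : forall f s, (f, false, s) \in arc_points (F ++ E).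
  by move=> f s; rewrite arc_points_cat mem_cat botE orbT.
have in_parallel f : f \notin L -> n f = 0 -> {subset parallel f <= parallel e ++ E}.
  move=> fL nf z zf; rewrite mem_cat.
  have [<- | fe] := eqVneq f e; first by rewrite zf.
  by rewrite (parE f) ?orbT // inE negb_or fe.
(* At label 0 the cut would break that hypothesis, but its weight is [S_0 = 0]. *)
have [n0 | n0] := eqVneq (n e) 0.
  have S0 : Spoly 0 A = 0 by apply: big_geq.
  rewrite n0 S0 mul0r mulr0 mul0r addr0 IH //.
  by rewrite /= n0 S0 !mul0r addr0 mulrA.
rewrite !IH //; last first.
  move=> f fL nf z zf; rewrite mem_cat (parE f) ?orbT // inE negb_or fL andbT.
  by apply: contraNneq n0 => <-; rewrite nf.
have distr (R : comNzRingType) (u v w s t : R) :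
  u * (w * s) + u * v * (w * t) = u * w * (s + v * t) by ring.
exact: distr.
Qed.

(** * The state polynomial of [K] *)

Local Notation i0 := (@Ordinal 3 0 isT).
Local Notation i1 := (@Ordinal 3 1 isT).
Local Notation i2 := (@Ordinal 3 2 isT).

Definition legs : seq leg :=
  [:: (true, i0); (false, i0); (true, i1); (false, i1); (true, i2); (false, i2)].

Lemma mem_legs (e : leg) : e \in legs.
Proof. by case: e => -[] [[|[|[|]]]]. Qed.

Definition K_skeleton : seq (twist_end * twist_end) :=
  flatten [seq
    [:: (((true, i), false, true), ((true, ordS i), false, false));
        (((true, i), true, true), ((false, i), false, false));
        (((false, i), false, true), ((true, ordS i), true, false));
        (((false, i), true, true), ((false, ordS i), true, false))]
    | i <- [:: i0; i1; i2]].

(* The three lines of products group the states by how the spokes present in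
   the state connect the rim vertices: not at all, in one pair, or all three.
   The last line is the excess of a pair closed up by its own rim edge. *)
Definition K_sum (R : comNzRingType) (d p q r a b c : R) : R :=
  (p * q + q * r + r * p + d * p * q * r)
    * (d ^+ 2 + d * (a + b + c) + (a * b + b * c + c * a + d * a * b * c))
  + (p + q + r) * (d + a + b + c + d * (a * b + b * c + c * a + d * a * b * c))
  + (1 + d * (a + b + c) + d ^+ 2 * (a * b + b * c + c * a + d * a * b * c))
  + (d ^+ 2 - 1) * (p * b + q * c + r * a).

Lemma state_sum_K (R : comNzRingType) (d : R) (y : leg -> R) :
  state_sum d y legs K_skeleton
  = K_sum d (y (true, i0)) (y (true, i1)) (y (true, i2))
            (y (false, i0)) (y (false, i1)) (y (false, i2)).
Proof.
cbn [state_sum legs]; rewrite /K_sum.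
(* The circles of each of the 64 crossingless states are counted by evaluation; the rest is a
   polynomial identity. *)
repeat match goal with |- context [ncircles ?E] =>
  let m := eval vm_compute in (ncircles E) in
  rewrite (_ : ncircles E = m); last by vm_compute
end.
by cbn [predn]; ring.
Qed.

Lemma bracket_K (p q r a b c : int) :
  bracket (K p q r a b c)
  = A ^ (- (p + q + r + a + b + c))
    * K_sum delta (Spoly p A * A ^ p) (Spoly q A * A ^ q) (Spoly r A * A ^ r)
                  (Spoly a A * A ^ a) (Spoly b A * A ^ b) (Spoly c A * A ^ c).
Proof.
pose u := tnth [tuple p; q; r]; pose v := tnth [tuple a; b; c].
pose n (e : leg) := if e.1 then u e.2 else v e.2.
have arcsE : arcs (K p q r a b c) = place_arcs (fun e => `|n e|%N) K_skeleton.
  by rewrite /= /K_arcs enum3.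
have crossingsE : crossings (K p q r a b c) = flatten [seq twist e (n e) | e <- legs].
  by rewrite /= /K_crossings enum3 /= -!catA.
rewrite /bracket arcsE crossingsE bracket_of_twists; first last.
- move=> e s.
  have /allP/(_ e (mem_legs e)) : all (fun e => all (fun s =>
      (e, false, s) \in arc_points K_skeleton) [:: true; false]) legs.
    by vm_compute.
  by move/allP; apply; case: s.
- by move=> e; rewrite mem_legs.
- by [].
rewrite state_sum_K !big_cons big_nil mulr1 -!expfzDr ?A_neq0 //.
rewrite /n /u /v !(tnth_nth 0) /=; congr (A ^ _ * _).
by lia.
Qed.

(** * The five differences *)

Lemma det_mx3 (R : comNzRingType) (a b c d e f g h i : R) :
  \det (mx3 [:: [:: a; b; c]; [:: d; e; f]; [:: g; h; i]])
  = a * (e * i - f * h) - b * (d * i - f * g) + c * (d * h - e * g).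
Proof.
rewrite (expand_det_row _ ord0) !big_ord_recl big_ord0 /cofactor.
rewrite !(expand_det_row _ ord0) !big_ord_recl !big_ord0 /cofactor !det_mx11.
rewrite !mxE /=.
by ring.
Qed.

Theorem lemma4p6 (p q r a b c : int) :
  let w := p + q + r + a + b + c in
  [/\ bracket (K p q r a b c) - bracket (K p q r b a c)
        = A ^ (- w) * (Spoly p A * A ^ p - Spoly r A * A ^ r)
            * (Spoly a A * A ^ a - Spoly b A * A ^ b)
            * (1 - (- A ^+ 2 - A ^- 2) ^+ 2),
      bracket (K p q r a b c) - bracket (K p q r a c b)
        = A ^ (- w) * (Spoly p A * A ^ p - Spoly q A * A ^ q)
            * (Spoly c A * A ^ c - Spoly b A * A ^ b)
            * (1 - (- A ^+ 2 - A ^- 2) ^+ 2),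
      bracket (K p q r a b c) - bracket (K p q r c b a)
        = A ^ (- w) * (Spoly q A * A ^ q - Spoly r A * A ^ r)
            * (Spoly a A * A ^ a - Spoly c A * A ^ c)
            * (1 - (- A ^+ 2 - A ^- 2) ^+ 2),
      bracket (K p q r a b c) - bracket (K p q r c a b)
        = A ^ (- w)
            * \det (mx3 [:: [:: Spoly p A * A ^ p; Spoly q A * A ^ q; Spoly r A * A ^ r];
                               [:: Spoly c A * A ^ c; Spoly a A * A ^ a; Spoly b A * A ^ b];
                               [:: 1; 1; 1]])
            * (1 - (- A ^+ 2 - A ^- 2) ^+ 2)
    & bracket (K p q r a b c) - bracket (K p q r b c a)
        = - A ^ (- w)
            * \det (mx3 [:: [:: Spoly p A * A ^ p; Spoly q A * A ^ q; Spoly r A * A ^ r];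
                               [:: Spoly a A * A ^ a; Spoly b A * A ^ b; Spoly c A * A ^ c];
                               [:: 1; 1; 1]])
            * (1 - (- A ^+ 2 - A ^- 2) ^+ 2)].
Proof.
(* Permuting [a], [b], [c] preserves [w], so all the brackets share the factor [A^-w]. *)
have perm_w (x y z : int) : x + y + z = a + b + c ->
    p + q + r + x + y + z = p + q + r + a + b + c by lia.
move=> w; rewrite !bracket_K !det_mx3 -/delta.
rewrite (perm_w b a c) ?(perm_w a c b) ?(perm_w c b a) ?(perm_w c a b)
  ?(perm_w b c a); try lia.
rewrite -/w /K_sum.
(* The equations hold with [A^-w], [delta] and the six weights as independent variables. *)
move: (A ^ (- w)) delta (Spoly p A * _) (Spoly q A * _) (Spoly r A * _)
  (Spoly a A * _) (Spoly b A * _) (Spoly c A * _) => {p q r a b c w perm_w}.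
move=> u d p q r a b c; split; ring.
Qed.
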